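(* Let $x$ be a Hall number and let $s \in \mathbb{N}$ satisfy $1 \le s < \frac{1}{5}x^{1/6}$. Then neither $x+s$ nor $x-s$ is a Hall number.
   Context: For a positive integer $x$ that is not a perfect square, let $k_x$ denote the distance between $x^3$ and the perfect square (square of an integer) closest to $x^3$, and let $r_x = \sqrt{x}/k_x$. A Hall number is a positive integer $x$ that is not a perfect square and satisfies $r_x > 1$. *)

(* Defs.v *)
From HB Require Import structures.
From mathcomp Require Import all_boot all_order all_algebra.
From mathcomp Require Import all_classical all_reals all_analysis.
From mathcomp Require Import zify.

Set Implicit Arguments.
Unset Strict Implicit.
Unset Printing Implicit Defensive.

Import Order.TTheory GRing.Theory Num.Theory.
Local Open Scope ring_scope.

Definition perfect_square (n : nat) : bool :=
  [exists m : 'I_n.+1, n == (m ^ 2)%N].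

Lemma perfect_squareP (n : nat) :
  reflect (exists m : int, n%:Z = m ^+ 2) (perfect_square n).
Proof.
apply: (iffP existsP) => [[m /eqP Em]|[m Em]]; first by exists (m : nat)%:Z; lia.
have En : n = (`|m| ^ 2)%N by lia.
have mn : (`|m| < n.+1)%N by nia.
by exists (Ordinal mn); apply/eqP.
Qed.

(* Subtraction on nat is truncated; the guard (d <= n) keeps only true
   squares below n. *)
Definition square_at_distance (n d : nat) : bool :=
  perfect_square (n + d) || (d <= n)%N && perfect_square (n - d).

Lemma square_at_distanceP (n d : nat) :
  reflect (exists m : int, `|n%:Z - m ^+ 2| = d%:Z) (square_at_distance n d).
Proof.
apply: (iffP orP) => [[/perfect_squareP[m Em]|/andP[dn /perfect_squareP[m Em]]]|[m Em]].
- by exists m; lia.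
- by exists m; lia.
have m2 : 0 <= m ^+ 2 by exact: sqr_ge0.
have [le_nm|lt_mn] := leP n%:Z (m ^+ 2); [left|right; apply/andP; split].
- by apply/perfect_squareP; exists m; lia.
- by lia.
- by apply/perfect_squareP; exists m; lia.
Qed.

Lemma exists_square_at_distance (n : nat) : exists d, square_at_distance n d.
Proof. by exists n; apply/square_at_distanceP; exists 0; lia. Qed.

(* The distance from x ^ 3 to its closest square is the least d such that some
   square lies at distance exactly d from x ^ 3. *)
Definition hall_k (x : nat) : nat := ex_minn (exists_square_at_distance (x ^ 3)).

Lemma hall_k_attained (x : nat) :
  exists m : int, `|(x ^ 3)%N%:Z - m ^+ 2| = (hall_k x)%:Z.
Proof. by rewrite /hall_k; case: ex_minnP => d /square_at_distanceP. Qed.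

Lemma hall_k_le (x : nat) (m : int) :
  (hall_k x)%:Z <= `|(x ^ 3)%N%:Z - m ^+ 2|.
Proof.
rewrite /hall_k; case: ex_minnP => d _ dmin.
rewrite -abszE lez_nat; apply: dmin; apply/square_at_distanceP.
by exists m; rewrite abszE.
Qed.

(* If x is not a perfect square then hall_k x > 0, so the quotient below never
   relies on the convention 0^-1 = 0 for the numbers x that matter. *)
Definition hall_r (R : realType) (x : nat) : R :=
  Num.sqrt x%:R / (hall_k x)%:R.

Definition hall_number (R : realType) (x : nat) : Prop :=
  [/\ (0 < x)%N, ~~ perfect_square x & 1 < hall_r R x].

(* Main.v *)
(* Suppose x and y = x + s satisfy x^3 = m^2 + a and y^3 = n^2 + b with a^2 < y
   and b^2 < y, and put z = x + y.  Expanding m n = sqrt ((x^3 - a) (y^3 - b))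
   gives 16 m n = 2 z^3 - 3 s^2 z - 8 (a + b) up to an error less than 1, which
   must then vanish, both sides being integers; this says 8 (n - m)^2 = 9 s^2 z.
   Hence z = 2 u^2, so s = 2 v is even and x = u^2 - v.  Now
   (u^2 - v)^(3/2) = (2 u^3 - 3 u v) / 2 + 3 v^2 / (8 u) + ..., where the third
   term is too small for m to be another half-integer than the first one, but
   too large compared with |a| / (2 m) for m to be equal to it. *)

Require Import Defs.
From mathcomp Require Import all_boot all_order all_algebra.
From mathcomp Require Import all_classical all_reals all_analysis.
From mathcomp Require Import zify ring.

Import Order.TTheory GRing.Theory Num.Theory.
Local Open Scope ring_scope.

Lemma hall_number_cube_near_square (R : realType) (x : nat) :
  hall_number R x ->
  exists m a : int, [/\ 0 <= m, x%:Z ^+ 3 = m ^+ 2 + a & a ^+ 2 < x%:Z].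
Proof.
case=> x_gt0 _; rewrite /hall_r => r_gt1.
have [m Em] := hall_k_attained x.
exists `|m|, ((x ^ 3)%N%:Z - m ^+ 2); split.
- by rewrite normr_ge0.
- by rewrite real_normK ?num_real //; lia.
(* At distance 0 the convention [invr0] makes the quotient 0, against [r_gt1]. *)
have k_gt0 : (0 < hall_k x)%N.
  by case: (hall_k x) r_gt1 => //; rewrite invr0 mulr0 ltr10.
rewrite -(@real_normK _ (_ - _)) ?num_real // Em.
move: r_gt1; rewrite ltr_pdivlMr ?ltr0n // mul1r => ltk.
have : ((hall_k x)%:R : R) ^+ 2 < x%:R.
  by rewrite -(@sqr_sqrtr R x%:R) ?ler0n // ltr_pXn2r // nnegrE ?sqrtr_ge0.
by rewrite -natrX ltr_nat; lia.
Qed.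

Lemma exp6_lt_of_lt_powR (R : realType) (x s : nat) :
  s%:R < 5^-1 * (x%:R : R) `^ 6^-1 -> ((5 * s) ^ 6 < x)%N.
Proof.
rewrite mulrC ltr_pdivlMr // -natrM mulnC => lt5s.
rewrite -(ltr_nat R) natrX.
have -> : x%:R = ((x%:R : R) `^ 6^-1) ^+ 6.
  by rewrite -powR_mulrn ?powR_ge0 // -powRrM mulVf ?powRr1 ?pnatr_eq0.
by rewrite ltr_pXn2r // nnegrE ?powR_ge0 ?ler0n.
Qed.

Lemma int_sqrt_floor (y : int) :
  0 <= y -> exists2 w : int, 0 <= w & w ^+ 2 <= y < (w + 1) ^+ 2.
Proof.
case: y => // n _; elim: n => [|n [w w_ge0 /andP[le_wn lt_nw]]].
  by exists 0.
have [lt1|le1] := ltP n.+1%:Z ((w + 1) ^+ 2).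
  by exists w => //; apply/andP; split=> //; lia.
by exists (w + 1); [lia | apply/andP; split; [|nia]].
Qed.

(** A nonzero integer [e] would force [|q| >= p]; this turns approximate equalities into exact
    ones. *)
Lemma int_mul_small (e p q : int) : `|q| < p -> e * p = q -> e = 0.
Proof. by move=> ltq Eq; nia. Qed.

(** Comparing squares, [c] divides [d]; the quotient has square [2 z], hence is even. *)
Lemma double_square_of_sqrM_double (c d z : int) :
  c != 0 -> d ^+ 2 = c ^+ 2 * (2 * z) -> exists2 u : int, 0 <= u & z = 2 * u ^+ 2.
Proof.
move=> c0 E.
have /dvdzP[t Et] : (c %| d)%Z by rewrite -(@dvdz_pexp2r _ _ 2) // E dvdz_mulr.
have Et2 : t ^+ 2 = 2 * z.
  have c20 : c ^+ 2 != 0 by rewrite expf_neq0.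
  by apply: (mulfI c20); rewrite -E Et exprMn mulrC.
have [u Eu] : exists u : int, t = 2 * u.
  have [u [Eu|Eu]] : exists u : int, t = 2 * u \/ t = 2 * u + 1.
    by exists (t %/ 2)%Z; lia.
  - by exists u.
  - by nia.
exists `|u|; first by rewrite normr_ge0.
by rewrite real_normK ?num_real //; nia.
Qed.

Lemma sqrD_norm_bound (a b w : int) :
  `|a| <= w -> `|b| <= w -> `|(a + b) ^+ 2| <= 4 * w ^+ 2.
Proof.
rewrite !ler_norml => /andP[a1 a2] /andP[b1 b2].
have lo : 0 <= 2 * w - (a + b) by lia.
have hi : 0 <= 2 * w + (a + b) by lia.
have := mulr_ge0 lo hi.
have -> : (2 * w - (a + b)) * (2 * w + (a + b)) = 4 * w ^+ 2 - (a + b) ^+ 2 by ring.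
by rewrite subr_ge0 => ->; rewrite andbT (le_trans _ (sqr_ge0 _)) //; nia.
Qed.

(* With z = x + y, s = y - x, a = x^3 - m^2 and b = y^3 - n^2, the left-hand side
   is the absolute value of (2 z^3 - 3 s^2 z - 8 (a + b))^2 - (16 m n)^2. *)
Lemma product_error_bound (z s w a b : int) :
  1 <= s -> 125 * s ^+ 3 <= w -> 3 * w ^+ 2 <= 2 * z -> `|a| <= w -> `|b| <= w ->
  `|- 3 * s ^+ 4 * z ^+ 2 + 4 * s ^+ 6 + 144 * s ^+ 2 * z * (a + b)
    + 64 * (a + b) ^+ 2 - 256 * (a * b)
    + 32 * (a - b) * (3 * z ^+ 2 * s + s ^+ 3)|
  < 2 * z ^+ 3 - 3 * s ^+ 2 * z - 8 * (a + b).
Proof.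
move=> s1 sw wz aw bw.
have s40 : 0 <= s ^+ 4 * z ^+ 2 by rewrite mulr_ge0 ?exprn_even_ge0.
have s60 : 0 <= s ^+ 6 by rewrite exprn_even_ge0.
have s2 : s <= s ^+ 2 by nia.
have s3 : s ^+ 2 <= s ^+ 3 by nia.
have w125 : 125 <= w by lia.
have w2 : 125 * w <= w ^+ 2 by nia.
have ws3 : 125 * (s ^+ 3 * w) <= w ^+ 2 by nia.
have ws2 : s ^+ 2 * w <= s ^+ 3 * w by nia.
have ws1 : s * w <= s ^+ 2 * w by nia.
have ws4 : s ^+ 4 <= s ^+ 3 * w by nia.
have ws6 : 125 * s ^+ 6 <= s ^+ 3 * w by nia.
have z_big : 15625 <= z by lia.
have z2 : 15625 * z <= z ^+ 2 by nia.
have z3 : 15625 * z ^+ 2 <= z ^+ 3 by nia.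
(* The factor 187 is 125 * 3/2 rounded down, from [125 s^3 w <= w^2 <= 2 z / 3]. *)
have B1 : 187 * (s ^+ 4 * z ^+ 2) <= z ^+ 3.
  have -> : z ^+ 3 = z * z ^+ 2 by ring.
  by rewrite mulrA; apply: ler_wpM2r; lia.
have B2 : 187 * (s ^+ 2 * w * z) <= z ^+ 2.
  have -> : z ^+ 2 = z * z by ring.
  by rewrite mulrA; apply: ler_wpM2r; lia.
have B3 : 187 * (s * w * z ^+ 2) <= z ^+ 3.
  have -> : z ^+ 3 = z * z ^+ 2 by ring.
  by rewrite mulrA; apply: ler_wpM2r; lia.
have B4 : s ^+ 2 * z <= s ^+ 2 * w * z by apply: ler_wpM2r; nia.
have C1 : `|s ^+ 2 * z * (a + b)| <= 2 * (s ^+ 2 * w * z).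
  have -> : 2 * (s ^+ 2 * w * z) = s ^+ 2 * z * (2 * w) by ring.
  by rewrite normrM ger0_norm; [apply: ler_wpM2l; [nia|lia] | nia].
have C2 : `|(a - b) * (z ^+ 2 * s)| <= 2 * (s * w * z ^+ 2).
  have -> : 2 * (s * w * z ^+ 2) = 2 * w * (z ^+ 2 * s) by ring.
  by rewrite normrM [`|_ * s|]ger0_norm; [apply: ler_wpM2r; [nia|lia] | nia].
have C3 : `|(a - b) * s ^+ 3| <= 2 * (s ^+ 3 * w).
  have -> : 2 * (s ^+ 3 * w) = 2 * w * s ^+ 3 by ring.
  by rewrite normrM [`|s ^+ 3|]ger0_norm; [apply: ler_wpM2r; [nia|lia] | nia].
have C4 := sqrD_norm_bound _ _ _ aw bw.
have C5 : `|a * b| <= w ^+ 2.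
  by rewrite normrM expr2; apply: ler_pM.
have -> : - 3 * s ^+ 4 * z ^+ 2 + 4 * s ^+ 6 + 144 * s ^+ 2 * z * (a + b)
    + 64 * (a + b) ^+ 2 - 256 * (a * b)
    + 32 * (a - b) * (3 * z ^+ 2 * s + s ^+ 3) =
  - 3 * (s ^+ 4 * z ^+ 2) + 4 * s ^+ 6 + 144 * (s ^+ 2 * z * (a + b))
    + 64 * (a + b) ^+ 2 - 256 * (a * b)
    + 96 * ((a - b) * (z ^+ 2 * s)) + 32 * ((a - b) * s ^+ 3) by ring.
rewrite -[3 * s ^+ 2 * z]mulrA.
(* With monomials as variables the goal is linear. The largest term, [96 (a - b) z^2 s], is at most
   [(192/187) z^3] in absolute value, against [2 z^3]. *)
move: (s ^+ 2 * z * (a + b)) ((a - b) * (z ^+ 2 * s)) ((a - b) * s ^+ 3)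
  ((a + b) ^+ 2) (a * b) C1 C2 C3 C4 C5 => c1 c2 c3 c4 c5.
move: (s ^+ 2 * w * z) (s * w * z ^+ 2) (s ^+ 4 * z ^+ 2) (s ^+ 2 * z)
  B1 B2 B3 B4 s40 => b2 b3 b1 b4.
move: (s ^+ 6) (s ^+ 3 * w) ws3 ws6 s60 => d1 d2.
move: (z ^+ 3) (z ^+ 2) (w ^+ 2) z2 z3 w2 w125 aw bw z_big wz.
clear; lia.
Qed.

(** [4 (u^2 - v)^3] exceeds [(2 u^3 - 3 u v)^2] by [3 u^2 v^2 - 4 v^3]. Subtracting [4 a] leaves
    this excess positive, yet too small for [2 m] to differ from [2 u^3 - 3 u v]. *)
Lemma shifted_square_cube_not_near_square (u v w a m : int) :
  1 <= v -> 1000 * v ^+ 3 <= w -> w ^+ 2 <= u ^+ 2 + v -> 0 <= u -> `|a| <= w ->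
  0 <= m -> (u ^+ 2 - v) ^+ 3 <> m ^+ 2 + a.
Proof.
move=> v1 vw wu u0 aw m0 E.
have E2 : (2 * m - (2 * u ^+ 3 - 3 * u * v)) * (2 * m + (2 * u ^+ 3 - 3 * u * v))
  = 3 * u ^+ 2 * v ^+ 2 - 4 * v ^+ 3 - 4 * a.
  have -> : a = (u ^+ 2 - v) ^+ 3 - m ^+ 2 by rewrite E; ring.
  by ring.
have v2 : v <= v ^+ 2 by clear -v1; nia.
have v3 : v ^+ 2 <= v ^+ 3 by clear -v1; nia.
have uw : w - 1 <= u by clear -v1 v2 v3 vw wu u0; nia.
(* The loss of 1 in [uw] is absorbed by one [v^3], so 1000 becomes 999. *)
have uv3 : 999 * v ^+ 3 <= u by lia.
have uv2 : 999 * v ^+ 2 <= u by lia.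
have uv1 : 999 * v <= u by lia.
have u999 : 999 <= u by lia.
have U3 : u ^+ 2 * (999 * v ^+ 2) <= u ^+ 2 * u.
  by apply: ler_wpM2l uv2; rewrite sqr_ge0.
have U2 : u * (999 * v) <= u * u by apply: ler_wpM2l uv1.
have U1 : u * 999 <= u * u by apply: ler_wpM2l u999.
have U0 : u ^+ 2 * 999 <= u ^+ 2 * u.
  by apply: ler_wpM2l u999; rewrite sqr_ge0.
have U4 : u ^+ 2 * 1 <= u ^+ 2 * v ^+ 2.
  by apply: ler_wpM2l; [rewrite sqr_ge0 | lia].
have lt0 : `|3 * u ^+ 2 * v ^+ 2 - 4 * v ^+ 3 - 4 * a|
    < 2 * m + (2 * u ^+ 3 - 3 * u * v).
  move: aw; rewrite ler_norml ltr_norml => /andP[a1 a2]; clear E2 E wu vw.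
  by apply/andP; split; lia.
(* The first factor of E2 is 0, but its right-hand side is positive. *)
have E0 := int_mul_small _ _ _ lt0 E2.
move: E2; rewrite E0 mul0r => E2.
move: aw; rewrite ler_norml => /andP[a1 a2]; clear E E0 lt0 wu vw.
lia.
Qed.

(** The smallness conditions refer only to the larger number [y], so that both [x + s] and [x - s]
    are covered. *)
Lemma near_square_cubes_gap (x y s m n a b : int) :
  1 <= s -> y = x + s -> 0 <= x -> (5 * s) ^+ 6 < y -> 0 <= m -> 0 <= n ->
  x ^+ 3 = m ^+ 2 + a -> y ^+ 3 = n ^+ 2 + b -> a ^+ 2 < y -> b ^+ 2 < y ->
  False.
Proof.
move=> s1 Ey x0 s6y m0 n0 Ex3 Ey3 ay bby.
have y0 : 0 <= y by clear -s1 Ey x0; lia.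
have [w w0 /andP[wy yw]] := int_sqrt_floor _ y0.
have aw : `|a| <= w by clear -w0 ay yw; nia.
have bw : `|b| <= w by clear -w0 bby yw; nia.
have sw : 125 * s ^+ 3 <= w.
  have s30 : 0 <= 125 * s ^+ 3 by rewrite mulr_ge0 // exprn_ge0 // (le_trans _ s1).
  have : (125 * s ^+ 3) ^+ 2 < (w + 1) ^+ 2.
    have -> : (125 * s ^+ 3) ^+ 2 = (5 * s) ^+ 6 by ring.
    exact: lt_trans s6y yw.
  by clear -w0 s30; nia.
have s_le : s <= s ^+ 3 by clear -s1; nia.
have wz : 3 * w ^+ 2 <= 2 * (x + y) by clear -s_le sw wy w0 s1 Ey; nia.
have := product_error_bound _ _ _ _ _ s1 sw wz aw bw.
set q := (X in `|X| < _) => ltq.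
have mn0 : 0 <= m * n by rewrite mulr_ge0.
(* With [z = x + y], the first factor equals [2 z^3 - 3 s^2 z - 8 (a + b) - 16 m n], because
   [8 (x^3 + y^3) = 2 z^3 + 6 s^2 z]. *)
have Eq : (8 * (n - m) ^+ 2 - 9 * s ^+ 2 * (x + y)) *
    (2 * (x + y) ^+ 3 - 3 * s ^+ 2 * (x + y) - 8 * (a + b) + 16 * (m * n)) = q.
  have Ea : a = x ^+ 3 - m ^+ 2 by rewrite Ex3 addrC addKr.
  have Eb : b = y ^+ 3 - n ^+ 2 by rewrite Ey3 addrC addKr.
  by rewrite /q Ea Eb Ey; ring.
have D0 := int_mul_small _ _ _ (lt_le_trans ltq _) Eq.
have {}D0 : 8 * (n - m) ^+ 2 = 9 * s ^+ 2 * (x + y).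
  by apply/eqP; rewrite -subr_eq0 D0 // lerDl mulr_ge0.
have s3_neq0 : 3 * s != 0 by clear -s1; lia.
have Esqr : (4 * (n - m)) ^+ 2 = (3 * s) ^+ 2 * (2 * (x + y)).
  have -> : (4 * (n - m)) ^+ 2 = 2 * (8 * (n - m) ^+ 2) by ring.
  by rewrite D0; ring.
have [u u0 Eu] := double_square_of_sqrM_double _ _ _ s3_neq0 Esqr.
clear ltq Eq Esqr D0 q mn0.
have [v Ev] : exists v, s = 2 * v by exists (u ^+ 2 - x); clear -Ey Eu; lia.
have Ex : x = u ^+ 2 - v by clear -Ey Eu Ev; lia.
(* Here [125 s^3 = 1000 v^3] and [y = u^2 + v]. *)
apply: (@shifted_square_cube_not_near_square u v w a m) => //; rewrite -?Ex //.
- by clear -s1 Ev; lia.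
- by move: sw; rewrite Ev; clear; lia.
- by clear -wy Ey Ex Ev; lia.
Qed.

Theorem theorem1 (R : realType) (x s : nat) (hx : hall_number R x)
    (hs1 : (1 <= s)%N) (hs2 : s%:R < 5^-1 * (x%:R : R) `^ 6^-1) :
  ~ hall_number R (x + s)%N /\ ~ hall_number R (x - s)%N.
Proof.
have s6 := @exp6_lt_of_lt_powR R x s hs2.
have [m [a [m0 Em am]]] := hall_number_cube_near_square _ _ hx.
have s6z : (5 * s%:Z) ^+ 6 < x%:Z by clear -s6; lia.
(* Ensures that the truncated [x - s] is the true difference. *)
have sx : s%:Z <= x.
  have : ((5 * s) ^ 1 <= (5 * s) ^ 6)%N by rewrite leq_pexp2l // muln_gt0.
  by clear -s6; lia.
split=> hy; have [n [b [n0 En bn]]] := hall_number_cube_near_square _ _ hy.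
- apply: (@near_square_cubes_gap x (x + s)%N s m n a b) => //; clear -hs1 s6z am; lia.
- apply: (@near_square_cubes_gap (x - s)%N x s n m b a) => //; clear -hs1 sx bn; lia.
Qed.
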